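(* Let $\alpha>0$, $\beta>0$, $n\ge0$ an integer and $t>0$. Let $w(x;t)=e^{-t/x}x^\alpha(1-x)^\beta$ on $[0,1]$ and $D_n(t)=\det\left(\int_0^1x^{i+j}w(x;t)\,dx\right)_{i,j=0}^{n-1}$. Then $$t\frac{d}{dt}\ln D_n(t)=-\sum_{j=0}^{n-1}R^*_j,$$ where $R_j^*:=\frac{t}{h_j}\int_0^1[P_j(y)]^2w(y;t)\frac{dy}{y}$.
   Context: $P_n$ is the monic polynomial of degree $n$ (depending on $t$) with $\int_0^1P_m(x)P_n(x)w(x;t)\,dx=h_n\delta_{m,n}$. Convention: $D_0:=1$ and the empty sum is $0$. *)

(* Defs.v *)
From mathcomp Require Import all_boot all_order all_algebra.
From mathcomp Require Import all_classical all_reals all_analysis.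

Set Implicit Arguments.
Unset Strict Implicit.
Unset Printing Implicit Defensive.

Import Order.TTheory GRing.Theory Num.Theory.
Import numFieldNormedType.Exports.

Local Open Scope classical_set_scope.
Local Open Scope ring_scope.

(* At [x = 0] the convention [0^-1 = 0] makes the exponential equal to [1], but
   [0 `^ alpha = 0] for [alpha > 0], so [weight alpha beta 0 t = 0]: this is the
   limit of the weight as [x] tends to [0] from the right when [t > 0]. *)
Definition weight (R : realType) (alpha beta x t : R) : R :=
  expR (- t / x) * x `^ alpha * (1 - x) `^ beta.

Definition moment (R : realType) (alpha beta : R) (k : nat) (t : R) : R :=
  \int[lebesgue_measure]_(x in `[0, 1]) (x ^+ k * weight alpha beta x t).

(* For [n = 0] this is the determinant of the empty matrix, that is, [1]. *)
Definition hankel (R : realType) (alpha beta : R) (n : nat) (t : R) : R :=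
  \det (\matrix_(i < n, j < n) moment alpha beta (i + j) t).

Definition monic_orthogonal (R : realType) (alpha beta t : R)
    (P : nat -> {poly R}) (h : nat -> R) : Prop :=
  (forall n, P n \is monic /\ size (P n) = n.+1) /\
  (forall m n,
    \int[lebesgue_measure]_(x in `[0, 1])
      ((P m).[x] * (P n).[x] * weight alpha beta x t) = h n * (m == n)%:R).

Definition Rstar (R : realType) (alpha beta t : R)
    (P : nat -> {poly R}) (h : nat -> R) (j : nat) : R :=
  t / h j * \int[lebesgue_measure]_(y in `[0, 1])
    ((P j).[y] ^+ 2 * weight alpha beta y t / y).

(* Main.v *)
(* Fix t and let C be the unitriangular matrix of coefficients of P_0, ...,
   P_(n-1). For every s, the moment matrix M(s) has the same determinant as
   G(s) = C M(s) C^T, the Gram matrix of the P_j for the weight w(.; s), and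
   G(t) is diagonal with entries h_j > 0. Hence only the diagonal of G'(t)
   enters the derivative of det G at t: (ln D_n)'(t) = \sum_j G'(t)_jj / h_j.
   Since the derivative of w(x; s) in s is - w(x; s) / x, which is dominated by
   1 / s, differentiation under the integral sign gives
   G'(t)_jj = - \int P_j^2 w / x = - R*_j h_j / t. *)
Require Import Defs.
From mathcomp Require Import all_boot all_order all_algebra.
From mathcomp Require Import all_classical all_reals all_analysis.
From mathcomp Require Import perm measurable_realfun ring lra.

Import Order.TTheory GRing.Theory Num.Theory.
Import numFieldNormedType.Exports.

Local Open Scope classical_set_scope.
Local Open Scope ring_scope.

(** * Derivatives of finite products and determinants *)

Section determinant_derivative.
Context {R : realType}.

Lemma is_derive_bigsum (I : Type) (r : seq I) (f : I -> R -> R) (df : I -> R)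
    (t : R) : (forall i, is_derive t 1 (f i) (df i)) ->
  is_derive t 1 (fun s => \sum_(i <- r) f i s) (\sum_(i <- r) df i).
Proof.
move=> fdf; rewrite -fct_sumE.
by elim/big_ind2 : _ => // [|] *; [exact: is_derive_cst|exact: is_deriveD].
Qed.

Lemma derivable_bigprod (I : Type) (r : seq I) (Q : pred I) (f : I -> R -> R)
    (t : R) : (forall i, derivable (f i) t 1) ->
  derivable (fun s => \prod_(i <- r | Q i) f i s) t 1.
Proof.
move=> df; rewrite -fct_prodE.
by elim/big_ind : _ => // *; exact: derivableM.
Qed.

(** The Leibniz rule in logarithmic form: as no factor vanishes at [t], a product with one factor
    omitted is a quotient. *)
Lemma is_derive_bigprod n (f : 'I_n -> R -> R) (df : 'I_n -> R) (t : R) :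
  (forall i, is_derive t 1 (f i) (df i)) -> (forall i, f i t != 0) ->
  is_derive t 1 (fun s => \prod_i f i s)
    ((\prod_i f i t) * \sum_i df i / f i t).
Proof.
move=> fdf f0; elim: n f df fdf f0 => [|n IH] f df fdf f0.
  have -> : (fun s => \prod_(i < 0) f i s) = cst 1.
    by apply/funext => s; rewrite big_ord0.
  by rewrite !big_ord0 mulr0; exact: is_derive_cst.
have -> : (fun s => \prod_(i < n.+1) f i s) =
  f ord0 * (fun s => \prod_(i < n) f (lift ord0 i) s).
  by apply/funext => s; rewrite big_ord_recl.
have IH1 := IH (fun i => f (lift ord0 i)) (fun i => df (lift ord0 i))
  (fun i => fdf _) (fun i => f0 _).
apply: is_derive_eq; rewrite !big_ord_recl /GRing.scale/=.
by field.
Qed.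

Lemma is_derive_det_diag n (G : R -> 'M[R]_n) (dG : 'M[R]_n) (t : R) :
  (forall i j, is_derive t 1 (fun s => G s i j) (dG i j)) ->
  (forall i j, i != j -> G t i j = 0) -> (forall i, G t i i != 0) ->
  is_derive t 1 (fun s => \det (G s))
    ((\prod_i G t i i) * \sum_i dG i i / G t i i).
Proof.
(* A non-identity permutation moves two points i and sg i, so its product has
   two off-diagonal factors vanishing at t and contributes nothing to the
   derivative. *)
move=> dGt offdiag diag.
pose d (sg : 'S_n) := if sg == 1%g then
  (\prod_i G t i i) * \sum_i dG i i / G t i i else 0.
suff dterm (sg : 'S_n) :
    is_derive t 1 (fun s => (-1) ^+ sg * \prod_i G s i (sg i)) (d sg).
  have := @is_derive_bigsum _ (index_enum 'S_n) _ _ t dterm.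
  by rewrite /d -big_mkcond big_pred1_eq.
have -> : (fun s => (-1) ^+ sg * \prod_i G s i (sg i)) =
    (-1) ^+ sg \*: (fun s => \prod_i G s i (sg i)) by [].
rewrite /d; case: eqVneq => [->|sg1].
  have -> : (fun s => \prod_i G s i ((1%g : 'S_n) i)) = fun s => \prod_i G s i i.
    by apply/funext => s; apply: eq_bigr => i _; rewrite perm1.
  have H := @is_derive_bigprod n (fun i s => G s i i) (fun i => dG i i) t
     (fun i => dGt i i) diag.
  by apply: is_derive_eq; rewrite odd_perm1 expr0 scale1r.
have [i sgi] : exists i, sg i != i.
  apply/existsP; apply: contraNT sg1 => /existsPn fix_all.
  by apply/eqP/permP => i; rewrite perm1; apply/eqP/negPn.
have sgsgi : sg (sg i) != sg i by rewrite (inj_eq perm_inj).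
have derG k : derivable (fun s => G s k (sg k)) t 1 by have [] := dGt k (sg k).
have dprod := @derivable_bigprod _ (index_enum 'I_n)
  (fun k => (k != i) && (k != sg i)) (fun k s => G s k (sg k)) t derG.
have -> : (fun s => \prod_i G s i (sg i)) =
  (fun s => G s i (sg i)) * ((fun s => G s (sg i) (sg (sg i))) *
   (fun s => \prod_(k | (k != i) && (k != sg i)) G s k (sg k))).
  by apply/funext => s; rewrite (bigD1 i)//= (bigD1 (sg i)).
(* Derivability of the remaining product is enough: the Leibniz rule multiplies its derivative by
   the two entries that vanish at [t]. *)
move/derivableP : dprod => dprod.
apply: is_derive_eq.
have Gi : G t i (sg i) = 0 by rewrite offdiag// eq_sym.
have Gsi : G t (sg i) (sg (sg i)) = 0 by rewrite offdiag// eq_sym.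
rewrite /GRing.scale/= Gi mul0r add0r.
by rewrite [X in X * dG _ _]/GRing.mul/= Gsi !mul0r mulr0.
Qed.

(** As [C] is constant, each entry of the congruence is a linear combination of entries of [A s]
    with coefficients independent of [s]. *)
Lemma is_derive_congruence n (A : R -> 'M[R]_n) (dA C : 'M[R]_n) (t : R) :
  (forall i j, is_derive t 1 (fun s => A s i j) (dA i j)) ->
  forall i j, is_derive t 1 (fun s => (C *m A s *m C^T) i j)
    ((C *m dA *m C^T) i j).
Proof.
move=> dAt i j.
have -> : (fun s => (C *m A s *m C^T) i j) =
    (fun s => \sum_k \sum_l (C j k * C i l) * A s l k).
  apply/funext => s; rewrite mxE; apply: eq_bigr => k _.
  rewrite !mxE mulr_suml; apply: eq_bigr => l _; ring.
rewrite mxE.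
have -> : \sum_k (C *m dA) i k * C^T k j = \sum_k \sum_l (C j k * C i l) * dA l k.
  apply: eq_bigr => k _.
  rewrite !mxE mulr_suml; apply: eq_bigr => l _; ring.
by do 2 apply: is_derive_bigsum => ?.
Qed.

End determinant_derivative.

(** * Linearity and positivity of integrals over the unit interval *)

Section unit_interval_integrals.
Context {R : realType}.
Let mu : measure _ _ := @lebesgue_measure R.
Implicit Types (g : R -> R) (p q : {poly R}).

(** Quantifying over all polynomials gives in one hypothesis the integrability of every moment and
    every Gram entry. It is applied to the weight and to the weight divided by [x]. *)
Definition polynomial_integrable (g : R -> R) :=
  forall p : {poly R},
    mu.-integrable `[0, 1] (EFin \o (fun x => p.[x] * g x)).

Lemma bounded_polynomial_integrable (g : R -> R) (M : R) :
  measurable_fun (`[0, 1] : set R) g ->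
  (forall x, 0 <= x <= 1 -> `|g x| <= M) -> polynomial_integrable g.
Proof.
move=> mg gM p.
apply: (@integrableMl _ _ _ mu _ _ (EFin \o horner p) g) => //.
- apply: continuous_compact_integrable; first exact: segment_compact.
  apply: continuous_subspaceT; exact: continuous_horner.
- exists M; split; rewrite ?num_real// => N MN x /=; rewrite in_itv/= => x01.
  exact: le_trans (gM _ x01) (ltW MN).
Qed.

Lemma Rintegral_horner_sum g n (c : 'I_n -> R) (F : 'I_n -> {poly R}) :
  polynomial_integrable g ->
  \int[mu]_(x in `[0, 1]) ((\sum_i c i *: F i).[x] * g x) =
  \sum_i c i * \int[mu]_(x in `[0, 1]) ((F i).[x] * g x).
Proof.
move=> ig.
have L0 : \int[mu]_(x in `[0, 1]) ((0 : {poly R}).[x] * g x) = 0.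
  rewrite (@eq_Rintegral _ _ _ mu _ (cst 0)) ?Rintegral_cst ?mul0r//.
  by move=> x _; rewrite horner0 mul0r.
have LD : {morph (fun p => \int[mu]_(x in `[0, 1]) (p.[x] * g x)) :
    p q / p + q}.
  move=> p q; rewrite -RintegralD//.
  by apply: eq_Rintegral => x _; rewrite hornerD mulrDl.
rewrite (big_morph _ LD L0); apply: eq_bigr => i _.
rewrite -RintegralZl//.
by apply: eq_Rintegral => x _; rewrite hornerZ mulrA.
Qed.

Lemma finite_set_root p : p != 0 -> finite_set [set x | root p x].
Proof.
move=> p0; apply: contrapT => /(@infinite_set_fset _ _ (size p))[B BA].
rewrite leqNgt => /negP; apply.
apply: max_poly_roots => //; last exact: finmap.fset_uniq.
by apply/allP => x xB; exact: BA.
Qed.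

(** A nonnegative integrand with zero integral vanishes almost everywhere. This one can vanish only
    at 0, 1 and the finitely many roots of [p], so the unit interval would have measure zero. *)
Lemma Rintegral_horner_gt0 g p :
  polynomial_integrable g -> p != 0 ->
  (forall x, 0 <= x <= 1 -> 0 <= g x) -> (forall x, 0 < x < 1 -> 0 < g x) ->
  0 < \int[mu]_(x in `[0, 1]) (p.[x] * p.[x] * g x).
Proof.
move=> ig p0 g0 g1.
have ge0 x : x \in `[0, 1] -> 0 <= p.[x] * p.[x] * g x.
  by rewrite in_itv/= => x01; rewrite mulr_ge0 ?g0// -expr2 sqr_ge0.
have ip : mu.-integrable `[0, 1] (EFin \o (fun x => p.[x] * p.[x] * g x)).
  have := ig (p * p); apply: eq_integrable => // x _ /=.
  by rewrite hornerM.
rewrite lt_neqAle Rintegral_ge0 ?andbT; last by move=> x /= /ge0.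
apply/eqP => i0.
have iabs0 : (\int[mu]_(x in (`[0%R, 1%R] : set R))
    `|(p.[x] * p.[x] * g x)%:E| = 0)%E.
  transitivity (\int[mu]_(x in (`[0%R, 1%R] : set R))
      (p.[x] * p.[x] * g x)%:E)%E.
    apply: eq_integral => x; rewrite inE/= => x01.
    by rewrite ger0_norm// ge0.
  rewrite -[LHS]fineK ?integrable_fin_num//.
  by congr EFin; rewrite [RHS]i0.
have ae0 := (ae_eq_integral_abs mu (measurable_itv _) (measurable_int _ ip)).1 iabs0.
have : mu `[0%R, 1%R]%classic = 0%E.
  apply/negligibleP => //.
  have n01 : mu.-negligible ([set 0] `|` [set 1] `|` [set x | root p x]).
    have cN : countable ([set 0] `|` [set 1] `|` [set x | root p x]).
      apply: finite_set_countable; rewrite !finite_setU; split => //.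
      exact: finite_set_root.
    apply/negligibleP; first exact: countable_measurable.
    exact: countable_lebesgue_measure0.
  apply: negligibleS (negligibleU ae0 n01) => x /= x01.
  have [->|x0] := eqVneq x 0; first by right; left; left.
  have [->|x1] := eqVneq x 1; first by right; left; right.
  have [px|px] := boolP (root p x); first by right; right.
  left => /(_ x01) [] /eqP; apply/negP; rewrite !mulf_neq0//.
  by rewrite gt_eqF// g1//; move: x01; rewrite in_itv/= !lt_neqAle x1 eq_sym x0.
rewrite [X in X = _](lebesgue_measure_itv `[0%R, 1%R])/= lte_fin ltr01 sube0 => /eqP.
by rewrite eqe oner_eq0.
Qed.

End unit_interval_integrals.

(** * Bounds on the weight and differentiation of the moments *)

Section weight_theory.
Context {R : realType}.
Let mu : measure _ _ := @lebesgue_measure R.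
Variables (alpha beta : R).
Hypotheses (alpha_gt0 : 0 < alpha) (beta_gt0 : 0 < beta).
Local Notation w := (weight alpha beta).

Lemma weight_ge0 x t : 0 <= w x t.
Proof. by rewrite /weight !mulr_ge0 ?expR_ge0 ?powR_ge0. Qed.

Lemma weight_gt0 x t : 0 < x < 1 -> 0 < w x t.
Proof.
by move=> /andP[x0 x1]; rewrite /weight !mulr_gt0 ?expR_gt0 ?powR_gt0 ?subr_gt0.
Qed.

Lemma weight_le x t : 0 <= x <= 1 -> w x t <= expR (- t / x).
Proof.
move=> /andP[x0 x1]; rewrite /weight -mulrA ler_piMr ?expR_ge0//.
have pow_le1 (y a : R) : 0 <= y <= 1 -> 0 < a -> y `^ a <= 1.
  move=> /andP[y0 y1] a0; apply: le_trans (ge0_ler_powR (ltW a0) _ _ y1) _;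
    by rewrite ?nnegrE ?powR1.
by rewrite mulr_ile1 ?powR_ge0// pow_le1//; lra.
Qed.

Lemma measurable_inv : measurable_fun (`[0, 1] : set R) (@GRing.inv R).
Proof.
(* The two functions agree at 0 as well, where both take the value 0. *)
apply: (eq_measurable_fun (fun x => x `^ (-1))).
  by move=> x; rewrite inE/= in_itv/= => /andP[x0 _]; rewrite powR_inv1.
exact: measurable_funTS.
Qed.

Lemma measurable_weight t : measurable_fun (`[0, 1] : set R) (w ^~ t).
Proof.
apply: measurable_funM; first apply: measurable_funM.
- apply: measurableT_comp => //; apply: measurable_funM => //.
  exact: measurable_inv.
- exact: measurable_funTS.
- apply: (measurableT_comp (measurable_powR _)) => //.
  exact: measurable_funB.
Qed.

Lemma weight_integrable t : 0 < t -> polynomial_integrable (w ^~ t).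
Proof.
move=> t0; apply: (@bounded_polynomial_integrable _ _ 1).
  exact: measurable_weight.
move=> x x01; rewrite ger0_norm ?weight_ge0//.
apply: le_trans (weight_le _ _ x01) _.
rewrite -expR0 ler_expR mulNr oppr_le0 divr_ge0//; lra.
Qed.

(** For [x > 0], put [u = t / x]: from [u <= 1 + u <= expR u] follows [expR (- u) <= x / t]. At
    [x = 0] the quotient is 0 by convention. *)
Lemma weightV_bound x t : 0 < t -> 0 <= x <= 1 -> `|w x t / x| <= t^-1.
Proof.
move=> t0 x01; rewrite ger0_norm ?divr_ge0 ?weight_ge0//; last by case/andP: x01.
have [->|x0] := eqVneq x 0; first by rewrite invr0 mulr0 invr_ge0 ltW.
have {}x0 : 0 < x by rewrite lt_neqAle eq_sym x0; case/andP: x01.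
rewrite ler_pdivrMr//; apply: le_trans (weight_le _ _ x01) _.
rewrite mulNr expRN [leRHS]mulrC -[leRHS]invrK lef_pV2 ?posrE ?expR_gt0 ?invr_gt0 ?divr_gt0//.
rewrite invf_div; apply: le_trans (expR_ge1Dx _).
by rewrite lerDr.
Qed.

Lemma weightV_integrable t : 0 < t ->
  polynomial_integrable (fun x => w x t / x).
Proof.
move=> t0; apply: (@bounded_polynomial_integrable _ _ t^-1).
  by apply: measurable_funM; [exact: measurable_weight|exact: measurable_inv].
by move=> x; exact: weightV_bound.
Qed.

(** Only the exponential depends on [t]. With [0^-1 = 0] the formula covers [x = 0] too: the weight
    is then constant in [t] and the right-hand side is 0. *)
Lemma is_derive_weight (x t : R) : is_derive t 1 (w x) (- (w x t / x)).
Proof.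
rewrite /weight.
have -> : (fun s => expR (- s / x) * x `^ alpha * (1 - x) `^ beta) =
    (x `^ alpha * (1 - x) `^ beta) *: (expR \o ((- x^-1) *: id)).
  apply/funext => s.
  transitivity ((x `^ alpha * (1 - x) `^ beta) * expR (- x^-1 * s)); last by [].
  by rewrite -mulrA mulrC !mulNr [s / x]mulrC.
apply: is_derive_eq.
have -> : (- x^-1 *: id) t = - t / x by rewrite mulNr [t / x]mulrC -mulNr.
rewrite /GRing.scale/=; ring.
Qed.

Lemma is_derive_moment k (t : R) : 0 < t ->
  is_derive t 1 (moment alpha beta k)
    (- \int[mu]_(x in `[0, 1]) (('X^k).[x] * (w x t / x))).
Proof.
move=> t0.
pose f s x := x ^+ k * w x s.
have df (s x : R) : is_derive s 1 (f ^~ x) (- (x ^+ k * (w x s / x))).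
  have dw := @is_derive_weight x s.
  have -> : f ^~ x = x ^+ k *: w x by [].
  by apply: is_derive_eq; rewrite /GRing.scale/= mulrN.
have p1 (s x : R) : partial1of2 f s x = - (x ^+ k * (w x s / x)).
  by rewrite partial1of2E; case: (df s x).
(* This neighbourhood of [t] stays away from 0, so the bound [s^-1] on the partial derivative is
   uniformly at most the constant [(t / 2)^-1], which is integrable. *)
have tI : `]t / 2, t * 2[%classic t by rewrite /= in_itv/=; lra.
have intf s : `]t / 2, t * 2[%classic s -> mu.-integrable `[0, 1] (EFin \o f s).
  rewrite /= in_itv/= => /andP[s0 _].
  have s_gt0 : 0 < s by apply: lt_trans s0; lra.
  have := @weight_integrable s s_gt0 'X^k; apply: eq_integrable => // x _.
  by rewrite /f /= hornerXn.
have intG : mu.-integrable (`[0, 1] : set R) (EFin \o (cst (t / 2)^-1)).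
  apply: continuous_compact_integrable; first exact: segment_compact.
  exact: cst_continuous.
have G_ub s x : `]t / 2, t * 2[%classic s -> `[0, 1]%classic x ->
    `|partial1of2 f s x| <= cst (t / 2)^-1 x.
  rewrite /= !in_itv/= p1 => /andP[s0 _] /andP[x0 x1].
  have s_gt0 : 0 < s by apply: lt_trans s0; lra.
  rewrite normrN normrM -[leRHS]mul1r ler_pM//.
    by rewrite ger0_norm ?exprn_ge0// exprn_ile1.
  apply: le_trans (weightV_bound _ _ s_gt0 _) _; first by rewrite x0.
  by rewrite lef_pV2 ?posrE ?ltW//; lra.
have G0 (y : R) : 0 <= cst (t / 2)^-1 y by rewrite invr_ge0; lra.
have dd s y : `]t / 2, t * 2[%classic s -> `[0, 1]%classic y -> derivable (f^~ y) s 1.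
  by move=> _ _; case: (df s y).
have D := @derivable_under_integral _ _ _ mu f _
  (measurable_itv `[0%R, 1%R]) _ _ _ tI intf dd _ G0 intG G_ub.
have E := @differentiation_under_integral _ _ _ mu f _
  (measurable_itv `[0%R, 1%R]) _ _ _ tI intf dd _ G0 intG G_ub.
apply: DeriveDef; first exact: D.
rewrite -derive1E E -mulN1r -RintegralZl//; last exact: weightV_integrable.
by apply: eq_Rintegral => x _; rewrite p1 hornerXn mulN1r.
Qed.

End weight_theory.

(** * Gram matrices and the logarithmic derivative *)

Lemma gram_matrix_congruence {R : realType} (g : R -> R) (P : nat -> {poly R}) n :
  polynomial_integrable g -> (forall i, size (P i) = i.+1) ->
  let C := \matrix_(i < n, k < n) (P i)`_k in
  let N := \matrix_(k < n, l < n)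
    \int[lebesgue_measure]_(x in `[0, 1]) (('X^(k + l)).[x] * g x) in
  C *m N *m C^T = \matrix_(i < n, j < n)
    \int[lebesgue_measure]_(x in `[0, 1]) ((P i).[x] * (P j).[x] * g x).
Proof.
move=> ig sizeP C N; apply/matrixP => i j; rewrite [RHS]mxE.
(* For [m < n] the degree of [P m] is below [n], so the first [n] monomials suffice; the Gram
   entries then expand by bilinearity. *)
have PE (m : 'I_n) : P m = \sum_(k < n) (P m)`_k *: 'X^k.
  rewrite -poly_def; apply/polyP => k; rewrite coef_poly.
  by case: ltnP => // nk; rewrite nth_default// sizeP (leq_trans _ nk).
transitivity (\int[lebesgue_measure]_(x in `[0, 1]) ((P i * P j).[x] * g x));
  last by apply: eq_Rintegral => x _; rewrite hornerM.
rewrite {1}[P i]PE mulr_suml.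
under eq_bigr do rewrite -scalerAl.
rewrite Rintegral_horner_sum//.
under [RHS]eq_bigr => k _.
  rewrite {1}[P j]PE mulr_sumr.
  under eq_bigr do rewrite -scalerAr -exprD.
  rewrite Rintegral_horner_sum//.
  over.
rewrite -mulmxA mxE; apply: eq_bigr => k _.
rewrite !mxE; congr (_ * _); apply: eq_bigr => l _.
by rewrite !mxE mulrC.
Qed.

Theorem lemma4p2 (R : realType) (alpha beta : R) (n : nat) (t : R)
    (P : nat -> {poly R}) (h : nat -> R)
    (alpha_gt0 : 0 < alpha) (beta_gt0 : 0 < beta) (t_gt0 : 0 < t)
    (orthoP : monic_orthogonal alpha beta t P h) :
  [/\ 0 < hankel alpha beta n t,
      derivable (fun s : R => ln (hankel alpha beta n s)) t 1 &
      t * derive1 (fun s : R => ln (hankel alpha beta n s)) t =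
        - \sum_(0 <= j < n) Rstar alpha beta t P h j].
Proof.
have [monP ortho] := orthoP.
have sizeP i : size (P i) = i.+1 by case: (monP i).
have iw := weight_integrable alpha beta alpha_gt0 beta_gt0 t t_gt0.
have iwV := weightV_integrable alpha beta alpha_gt0 beta_gt0 t t_gt0.
(* Orthogonality with equal indices identifies [h j] with the integral of the squared polynomial
   against the weight. *)
have h_gt0 j : 0 < h j.
  have := ortho j j; rewrite eqxx mulr1 => <-.
  apply: Rintegral_horner_gt0 => //.
  - by rewrite -size_poly_gt0 sizeP.
  - by move=> x _; exact: weight_ge0.
  - by move=> x; exact: weight_gt0.
pose C := \matrix_(i < n, k < n) (P i)`_k.
pose M s := \matrix_(i < n, j < n) moment alpha beta (i + j) s.
pose G s := C *m M s *m C^T.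
pose V (j : nat) := \int[lebesgue_measure]_(x in `[0, 1])
  ((P j).[x] * (P j).[x] * (weight alpha beta x t / x)).
(* The degrees make [C] lower triangular, and monicity puts 1 on its diagonal. *)
have detC : \det C = 1.
  rewrite det_trig.
    apply: big1 => i _; rewrite mxE.
    by case: (monP i) => /monicP; rewrite lead_coefE sizeP.
  by apply/is_trig_mxP => i j ij; rewrite mxE nth_default// sizeP.
(* Purely algebraic, hence valid for every [s]: the polynomials in [C] stay those of the fixed
   [t]. *)
have hankelE s : hankel alpha beta n s = \det (G s).
  by rewrite !det_mulmx det_tr detC mul1r mulr1.
have Gt i j : G t i j = h j * (i == j :> nat)%:R.
  have := gram_matrix_congruence _ _ n iw sizeP => /matrixP/(_ i j).
  rewrite [RHS]mxE ortho => <-.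
  congr (_ i j); congr (_ *m _ *m _); apply/matrixP => k l; rewrite !mxE.
  by apply: eq_Rintegral => x _; rewrite hornerXn.
have detGt : \det (G t) = \prod_(i < n) G t i i.
  by rewrite det_trig//; apply/is_trig_mxP => i j ij; rewrite Gt ltn_eqF// mulr0.
have Gtii (i : 'I_n) : G t i i = h i by rewrite Gt eqxx mulr1.
have detG_gt0 : 0 < \det (G t).
  by rewrite detGt; apply: prodr_gt0 => i _; rewrite Gtii.
pose N := \matrix_(k < n, l < n) \int[lebesgue_measure]_(x in `[0, 1])
  (('X^(k + l)).[x] * (weight alpha beta x t / x)).
have dM k l : is_derive t 1 (fun s => M s k l) ((- N) k l).
  have -> : (fun s => M s k l) = moment alpha beta (k + l).
    by apply/funext => s; rewrite mxE.
  by rewrite !mxE; exact: is_derive_moment.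
(* The Gram identity again, now with the weight divided by [x]. *)
have dGii i : (C *m (- N) *m C^T) i i = - V i.
  by rewrite mulmxN mulNmx mxE gram_matrix_congruence// mxE.
have dlogdet : is_derive t 1 (fun s => ln (hankel alpha beta n s))
    (\sum_(i < n) - V i / h i).
  have -> : (fun s => ln (hankel alpha beta n s)) = (@ln R) \o (fun s => \det (G s)).
    by apply/funext => s /=; rewrite hankelE.
  have offdiag (i j : 'I_n) : i != j -> G t i j = 0.
    by move=> ij; rewrite Gt val_eqE (negbTE ij) mulr0.
  have diag (i : 'I_n) : G t i i != 0 by rewrite Gtii gt_eqF.
  have ddet := is_derive_det_diag n G _ t (is_derive_congruence n M _ C t dM)
    offdiag diag.
  have dln := is_derive1_ln detG_gt0.
  (* The factor [(\det (G t))^-1] from the logarithm cancels the product of the diagonal entries. *)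
  apply: is_derive_eq; rewrite detGt mulKf -?detGt ?gt_eqF//.
  by apply: eq_bigr => i _; rewrite dGii Gtii.
split; [by rewrite hankelE|by case: dlogdet|].
rewrite derive1E; case: dlogdet => _ ->.
rewrite mulr_sumr -sumrN big_mkord; apply: eq_bigr => i _.
have -> : Rstar alpha beta t P h i = t / h i * V i.
  by congr (_ * _); apply: eq_Rintegral => x _; rewrite expr2 [RHS]mulrA.
ring.
Qed.
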